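(* The collection of all directed effective-monic cones on $\mathsf{CHaus}$ is not a coverage.
   Context: $\mathsf{CHaus}$ is the category of compact Hausdorff spaces and continuous maps. A cone in $\mathsf{CHaus}$ is a small family of morphisms $\{f_i:X\to Y_i\}_{i\in I}$ with common domain. For a functor $F:\mathsf{CHaus}\to\mathsf{Set}$, a family $(\beta_i)_{i\in I}$ with $\beta_i\in F(Y_i)$ is compatible if for all $i,j\in I$ and all morphisms $g:Y_i\to Z$, $h:Y_j\to Z$ with $gf_i=hf_j$ one has $F(g)(\beta_i)=F(h)(\beta_j)$. $F$ satisfies the sheaf condition on $\{f_i\}$ if $\alpha\mapsto (F(f_i)(\alpha))_{i\in I}$ is a bijection from $F(X)$ to the set of compatible families. A cone is effective-monic if every representable functor $\mathsf{CHaus}(W,-)$ satisfies the sheaf condition on it. A cone $\{g_j:Y\to Z_j\}_j$ separates points if the $g_j$ are jointly injective. An effective-monic cone $\{f_i:X\to Y_i\}_{i\in I}$ is directed if for every $i\in I$ there is a cone $\{g_i^j:Y_i\to Z_i^j\}_{j\in J_i}$ which separates points, such that for all $i,i'\in I$, $j\in J_i$, $j'\in J_{i'}$ there are $k\in I$ and morphisms $p:Y_k\to Z_i^j$, $q:Y_k\to Z_{i'}^{j'}$ with $pf_k=g_i^jf_i$ and $qf_k=g_{i'}^{j'}f_{i'}$. A collection $\mathcal{K}$ of cones in $\mathsf{CHaus}$ is a coverage (in the covariant sense, i.e. a coverage on $\mathsf{CHaus}^{\mathrm{op}}$) if for every cone $\{f_i:X\to Y_i\}_{i\in I}$ in $\mathcal{K}$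 and every morphism $h:X\to X'$ there is a cone $\{k_j:X'\to Z_j\}_{j\in J}$ in $\mathcal{K}$ such that for every $j\in J$ the composite $k_jh:X\to Z_j$ factors as $k_jh=m f_i$ for some $i\in I$ and some morphism $m:Y_i\to Z_j$. *)

(* Defs.v *)
From HB Require Import structures.
From mathcomp Require Import all_boot all_classical.
From mathcomp Require Import topology_structure compact separation_axioms.
From mathcomp Require Import function_spaces.

Set Implicit Arguments.
Unset Strict Implicit.
Unset Printing Implicit Defensive.

Local Open Scope classical_set_scope.

(* The universe of the carriers of topological spaces: being a small set means
   living in it, both for index types of cones and for values of functors to
   Set. *)
Definition smallType := Type@{Topological.axioms_.u0}.

Record chaus := CHaus {
  chaus_space :> topologicalType;
  chaus_compact : compact [set: chaus_space];
  chaus_hausdorff : hausdorff_space chaus_space }.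

Definition chom (X Y : chaus) : smallType := continuousType X Y.

Definition chom_fun (X Y : chaus) (f : chom X Y) : X -> Y :=
  (f : continuousType X Y).
Coercion chom_fun : chom >-> Funclass.

Definition chom_id (X : chaus) : chom X X := idfun : continuousType X X.

Definition chom_comp (X Y Z : chaus) (g : chom Y Z) (f : chom X Y) :
    chom X Z :=
  (g : continuousType Y Z) \o (f : continuousType X Y) : continuousType X Z.
Arguments chom_comp {X Y Z} g f : simpl never.

Lemma chom_compE (X Y Z : chaus) (g : chom Y Z) (f : chom X Y) (x : X) :
  chom_comp g f x = g (f x).
Proof. by []. Qed.

Lemma chomP (X Y : chaus) (f g : chom X Y) : f = g <-> f =1 g.
Proof. by rewrite continuousEP. Qed.

Lemma chom_comp1 (X Y : chaus) (f : chom X Y) : chom_comp f (chom_id X) = f.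
Proof. exact/chomP. Qed.

Lemma chom_1comp (X Y : chaus) (f : chom X Y) : chom_comp (chom_id Y) f = f.
Proof. exact/chomP. Qed.

Lemma chom_compA (X Y Z T : chaus) (h : chom Z T) (g : chom Y Z) (f : chom X Y) :
  chom_comp (chom_comp h g) f = chom_comp h (chom_comp g f).
Proof. exact/chomP. Qed.

Record set_functor := SetFunctor {
  fobj :> chaus -> smallType;
  fmap : forall X Y : chaus, chom X Y -> fobj X -> fobj Y;
  fmap_id : forall (X : chaus) (a : fobj X), fmap (chom_id X) a = a;
  fmap_comp : forall (X Y Z : chaus) (g : chom Y Z) (f : chom X Y)
    (a : fobj X), fmap (chom_comp g f) a = fmap g (fmap f a) }.

Definition representable (W : chaus) : set_functor :=
  @SetFunctor (chom W) (fun X Y f a => chom_comp f a)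
    (fun X a => chom_1comp a) (fun X Y Z g f a => chom_compA g f a).

Record cone (X : chaus) := Cone {
  cone_idx : smallType;
  cone_cod : cone_idx -> chaus;
  cone_leg :> forall i : cone_idx, chom X (cone_cod i) }.

Definition compatible (F : set_functor) (X : chaus) (f : cone X)
    (b : forall i : cone_idx f, F (cone_cod i)) : Prop :=
  forall (i j : cone_idx f) (Z : chaus)
    (g : chom (cone_cod i) Z) (h : chom (cone_cod j) Z),
    chom_comp g (f i) = chom_comp h (f j) -> fmap g (b i) = fmap h (b j).

Definition sheaf_condition (F : set_functor) (X : chaus) (f : cone X) : Prop :=
  set_bij [set: F X] [set b | compatible b]
    (fun a => fun i : cone_idx f => fmap (f i) a).

Definition effective_monic (X : chaus) (f : cone X) : Prop :=
  forall W : chaus, sheaf_condition (representable W) f.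

Definition separates_points (Y : chaus) (g : cone Y) : Prop :=
  forall y y' : Y, (forall j : cone_idx g, g j y = g j y') -> y = y'.

Definition directed (X : chaus) (f : cone X) : Prop :=
  exists g : forall i : cone_idx f, cone (cone_cod i),
    (forall i : cone_idx f, separates_points (g i)) /\
    forall (i i' : cone_idx f) (j : cone_idx (g i)) (j' : cone_idx (g i')),
      exists (k : cone_idx f) (p : chom (cone_cod k) (cone_cod j))
             (q : chom (cone_cod k) (cone_cod j')),
        chom_comp p (f k) = chom_comp (g i j) (f i) /\
        chom_comp q (f k) = chom_comp (g i' j') (f i').

Definition directed_effective_monic (X : chaus) (f : cone X) : Prop :=
  effective_monic f /\ directed f.

Definition coverage (K : forall X : chaus, cone X -> Prop) : Prop :=
  forall (X : chaus) (f : cone X), K X f ->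
  forall (X' : chaus) (h : chom X X'),
    exists k : cone X', K X' k /\
      forall j : cone_idx k,
        exists (i : cone_idx f) (m : chom (cone_cod i) (cone_cod j)),
          chom_comp (k j) h = chom_comp m (f i).

(* Main.v *)
Require Import Defs.
From HB Require Import structures.
From mathcomp Require Import all_boot all_classical.
From mathcomp Require Import topology_structure compact separation_axioms.
From mathcomp Require Import discrete_topology.

Set Implicit Arguments.
Unset Strict Implicit.
Unset Printing Implicit Defensive.

Local Open Scope classical_set_scope.

(** Directedness asks that any two basic observations be made jointly by one
    leg, but says nothing about three; and the parity of three bits cannot be
    detected, even partially, from any two of them.

    On the discrete cube 2^3, the three coordinate projections [x s] are
    grouped into the legs [x |-> (x s, x s')], one for each ordered pair
    [(s, s')].  This cone is directed: each leg is separated by its two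
    coordinates, and any two coordinates are jointly read off by the leg that
    they index.  It is effective-monic: compatibility says that a coordinate
    gets the same value from every leg that contains it, so a compatible family
    is the same as a choice of the coordinates, that is a map to the cube
    ([pair_cone_directed_effective_monic]).

    Push this cone forward along the parity map [2^3 -> 2].  A leg [k] of a
    refining cone on [2] is such that [k (parity x)] depends on two of the
    three coordinates of [x]; flipping the remaining one changes the parity,
    hence [k] is constant ([parity_two_coordinates]).  But the legs of an
    effective-monic cone separate points ([effective_monic_separates]), whereas
    all legs here identify the two points of [2]. *)

Lemma fin_discrete_compact (T : finType) :
  compact [set: discrete_topology T].
Proof. by apply: finite_compact; exact: (@finite_finset T). Qed.

Definition fin_chaus (T : finType) : chaus :=
  CHaus (@fin_discrete_compact T) (@discrete_hausdorff (discrete_topology T)).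

Lemma fin_continuous (T : finType) (Z : topologicalType)
  (f : discrete_topology T -> Z) : continuous f.
Proof.
move=> x A /nbhs_singleton Afx.
by rewrite nbhs_principalE; apply/principal_filterP.
Qed.

Definition chom_of (X Y : chaus) (f : X -> Y) (cf : continuous f) : chom X Y :=
  HB.pack_for (continuousType X Y) f (isContinuous.Build X Y f cf).

Lemma chom_continuous (X Y : chaus) (f : chom X Y) : continuous (f : X -> Y).
Proof. exact: (@cts_fun _ _ (f : continuousType X Y)). Qed.

Definition fin_chom (T : finType) (Z : chaus) (f : T -> Z) :
    chom (fin_chaus T) Z :=
  @chom_of (fin_chaus T) Z f (@fin_continuous T Z f).

(** A map to a finite power of a finite space is locally constant as soon as
    its finitely many coordinates are. *)
Lemma continuous_to_ffun (S T : finType) (W : topologicalType)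
    (a : W -> discrete_topology {ffun S -> T}) :
  (forall s, continuous (fun w => a w s : discrete_topology T)) ->
  continuous a.
Proof.
move=> ca w; apply/(@discrete_cvg (discrete_topology {ffun S -> T})).
have /filter_forall : forall s, \forall w' \near w, a w' s = a w s.
  move=> s; exact: (ca s w _ (@discrete_set1 (discrete_topology T) (a w s))).
by apply: filterS => w' eq_a; apply/ffunP.
Qed.

(** Points of [X] are maps to [X] from the one-point space, and these are
    determined by their composites with the legs. *)
Lemma effective_monic_separates (X : chaus) (f : cone X) :
  effective_monic f -> separates_points f.
Proof.
move=> /(_ (fin_chaus unit)) [_ inj_f _] x y eq_f.
pose pt (z : X) : chom (fin_chaus unit) X := fin_chom (fun=> z).
have /chomP/(_ tt) : pt x = pt y.
  apply: inj_f; rewrite ?inE //; apply/functional_extensionality_dep => i.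
  by apply/chomP => w; exact: eq_f.
exact.
Qed.

Section PairCone.
Variables S T : finType.

Definition pair_cone : cone (fin_chaus {ffun S -> T}) :=
  @Cone _ (S * S)%type (fun=> fin_chaus (T * T)%type)
    (fun i => fin_chom (fun x : {ffun S -> T} => (x i.1, x i.2) : fin_chaus _)).

Definition pair_fst : chom (fin_chaus (T * T)%type) (fin_chaus T) :=
  fin_chom (fst : T * T -> fin_chaus T).

Definition pair_snd : chom (fin_chaus (T * T)%type) (fin_chaus T) :=
  fin_chom (snd : T * T -> fin_chaus T).

Lemma pair_cone_effective_monic : effective_monic pair_cone.
Proof.
move=> W; split=> /=.
- move=> a _ i j Z g h /chomP eq_gh; apply/chomP => w; exact: eq_gh.
- move=> a a' _ _ eq_a; apply/chomP => w; apply/ffunP => s.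
  by have /chomP/(_ w) [] := f_equal (fun b => b (s, s)) eq_a.
move=> b comp_b.
(* The coordinate [s] of the glued map can be read off any leg containing [s];
   the diagonal leg is the canonical choice. *)
pose c s : chom W (fin_chaus T) := chom_comp pair_fst (b (s, s)).
have fst_b s s' : chom_comp pair_fst (b (s, s')) = c s.
  by apply: comp_b; exact/chomP.
have snd_b s s' : chom_comp pair_snd (b (s, s')) = c s'.
  by apply: comp_b; exact/chomP.
pose a (w : W) : fin_chaus {ffun S -> T} := [ffun s => c s w].
have a_continuous : continuous a.
  apply: continuous_to_ffun => s.
  have -> : (fun w => a w s) = c s by apply/funext => w; exact: ffunE.
  exact: (@chom_continuous W (fin_chaus T) (c s)).
exists (chom_of a_continuous) => //.
apply/functional_extensionality_dep => -[s s']; apply/chomP => w.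
have fst_bw : (b (s, s') w).1 = c s w := proj1 (chomP _ _) (fst_b s s') w.
have snd_bw : (b (s, s') w).2 = c s' w := proj1 (chomP _ _) (snd_b s s') w.
rewrite (surjective_pairing (b (s, s') w)) fst_bw snd_bw.
by congr pair; exact: ffunE.
Qed.

Lemma pair_cone_directed : directed pair_cone.
Proof.
pose coord (i : S * S) (j : bool) : S := if j then i.2 else i.1.
exists (fun=> @Cone _ bool (fun=> fin_chaus T)
          (fun j => if j then pair_snd else pair_fst)); split.
  move=> i [u v] [u' v'] eq_g.
  by congr pair; [exact: (eq_g false)|exact: (eq_g true)].
move=> i i' j j'; exists (coord i j, coord i' j'), pair_fst, pair_snd.
by split; apply/chomP => x; [case: j|case: j'].
Qed.

Lemma pair_cone_directed_effective_monic : directed_effective_monic pair_cone.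
Proof.
by split; [exact: pair_cone_effective_monic|exact: pair_cone_directed].
Qed.

End PairCone.

Definition parity (S : finType) (x : {ffun S -> bool}) : bool :=
  \big[addb/false]_s x s.

Lemma parity_zero (S : finType) : parity [ffun _ : S => false] = false.
Proof. by apply: big1 => s _; rewrite ffunE. Qed.

Lemma parity_delta (S : finType) (u : S) : parity [ffun s => s == u] = true.
Proof.
by rewrite /parity (bigD1 u) //= ffunE eqxx big1 // => s /negPf; rewrite ffunE.
Qed.

(** Flipping a coordinate other than the two observed ones, which exists as
    soon as there are three, changes the parity but not the observation. *)
Lemma parity_two_coordinates (S : finType) (Z : Type) (k : bool -> Z)
    (m : bool * bool -> Z) (s s' : S) :
  2 < #|S| -> (forall x : {ffun S -> bool}, k (parity x) = m (x s, x s')) ->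
  k false = k true.
Proof.
move=> S_gt2 km.
have [u uP] : exists u, u \notin [set s; s']%SET.
  apply/existsP; rewrite -negb_forall; apply: contraL S_gt2 => /forallP sub.
  rewrite -leqNgt -cardsT (leq_trans (n := #|[set s; s']%SET|)) //.
    by apply: subset_leq_card; apply/fintype.subsetP => u _; exact: sub.
  by rewrite cards2; case: eqP.
move: uP; rewrite !inE negb_or => /andP[/negPf us /negPf us'].
rewrite -(parity_zero S) -(parity_delta u) !km !ffunE.
by rewrite eq_sym us eq_sym us'.
Qed.

Theorem proposition3p28 : ~ coverage directed_effective_monic.
Proof.
pose h : chom (fin_chaus {ffun 'I_3 -> bool}) (fin_chaus bool) :=
  fin_chom (@parity 'I_3 : _ -> fin_chaus bool).
move=> /(_ _ _ (pair_cone_directed_effective_monic 'I_3 bool) _ h).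
move=> [k [[/effective_monic_separates sep_k _] fact_k]].
suff : false = true by [].
apply: sep_k => j; have [[s s'] [m /chomP km]] := fact_k j.
by apply: parity_two_coordinates km; rewrite card_ord.
Qed.
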